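(* Fix $n\ge 1$ and consider the raw-score predictive recursion described in the context. Suppose that, conditional on $X_{1:n}$: (i) $\mathbb E(s_{n,m}\mid\mathcal F_{n,m-1})=0$ for all $m\ge1$; (ii) $\mathbb E\bigl[\sum_{m\ge1}\gamma_m^2\|s_{n,m}\|^2\,\big|\,X_{1:n}\bigr]<\infty$ almost surely; (iii) $Q_{n,M}\to Q_{n,\infty}$ almost surely as $M\to\infty$, where $Q_{n,\infty}$ is finite and positive definite. Then, as $M\to\infty$, $D_{n,M}=\sum_{m=1}^M\gamma_m s_{n,m}$ converges almost surely and in $L^2$ under the conditional predictive law (given $X_{1:n}$) to a finite random variable $D_{n,\infty}$. Consequently $$\theta_{n,M}=\theta_{n,0}+D_{n,M}\to\theta_{n,\infty}:=\theta_{n,0}+D_{n,\infty}\quad\text{a.s.}$$ Moreover, $$\widehat I^{\mathrm{path}}_{n,M}=Q_{n,M}/w_{n,M}\to\widehat I^{\mathrm{path}}_{n,\infty}:=Q_{n,\infty}/w_{n,\infty}\quad\text{a.s.}$$ If $Q_{n,\infty}$ is positive definite, then the pathwise post-corrected draw $\theta^{\mathrm{pc}}_{n,M}=\theta_{n,0}+(\widehat I^{\mathrm{path}}_{n,M})^{-1}D_{n,M}$ converges almost surely to $$\theta^{\mathrm{pc}}_{n,\infty}=\theta_{n,0}+(\widehat I^{\mathrm{path}}_{n,\infty})^{-1}D_{n,\infty}.$$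
   Context: Let $\{p(x\mid\theta):\theta\in\Theta\subseteq\mathbb R^p\}$ be a parametric model with score $s(x,\theta)=\nabla_\theta\log p(x\mid\theta)$. Let $X_{1:n}=(X_1,\dots,X_n)$ be observed data and $\theta_{n,0}$ an initial estimator (the maximum likelihood estimator), a function of $X_{1:n}$. Conditional on $X_{1:n}$, the raw-score predictive recursion generates, for $m\ge1$, $$\widetilde X_{n+m}\mid\mathcal F_{n,m-1}\sim p(\cdot\mid\theta_{n,m-1}),\qquad \theta_{n,m}=\theta_{n,m-1}+\gamma_m s_{n,m},$$ with $\gamma_m=(n+m)^{-1}$, $s_{n,m}=s(\widetilde X_{n+m},\theta_{n,m-1})$, and $\mathcal F_{n,m}=\sigma\{X_{1:n},\widetilde X_{n+1},\dots,\widetilde X_{n+m}\}$. The recursion is understood to be well defined (all $\theta_{n,m}\in\Theta$). Define $Q_{n,M}=\sum_{m=1}^M\gamma_m^2 s_{n,m}s_{n,m}^\top$, $w_{n,M}=\sum_{m=1}^M\gamma_m^2$, $w_{n,\infty}=\sum_{m\ge1}\gamma_m^2$. The inverse in $\theta^{\mathrm{pc}}_{n,M}$ is considered for all $M$ large enough that $\widehat I^{\mathrm{path}}_{n,M}$ is invertible. *)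

(* Defs.v *)
From mathcomp Require Export all_boot all_order all_algebra.
From mathcomp Require Export all_classical all_reals all_analysis.
From mathcomp Require Export measurable_realfun.
Export Order.TTheory GRing.Theory Num.Theory.
Export numFieldNormedType.Exports.

Set Implicit Arguments.
Unset Strict Implicit.
Unset Printing Implicit Defensive.

Local Open Scope classical_set_scope.
Local Open Scope ring_scope.

(* The norm carried by matrices in the library is the max norm; this is the
   squared Euclidean norm. *)
Definition sqnorm (R : realType) (p : nat) (v : 'cV[R]_p) : R :=
  \sum_(i < p) v i 0 ^+ 2.

Definition posdefmx (R : realType) (p : nat) (A : 'M[R]_p) : Prop :=
  A^T = A /\ forall v : 'cV[R]_p, v != 0 -> 0 < (v^T *m A *m v) 0 0.

Section conditional_expectation.
Context {d : measure_display} {Omega : measurableType d} {R : realType}.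
Variables (P : probability Omega R) (G : set (set Omega)).

(* Z is a version of E(Y | G), for a measurable Y with values in [0, +oo] and
   a sub-sigma-algebra G; no integrability of Y is required. *)
Definition cond_exp_ge0 (Y Z : Omega -> \bar R) : Prop :=
  [/\ forall w, (0 <= Z w)%E,
      forall B : set (\bar R), measurable B -> G (Z @^-1` B) &
      forall A, G A -> (\int[P]_(w in A) Z w = \int[P]_(w in A) Y w)%E].

Definition cond_exp_finite (Y : Omega -> \bar R) : Prop :=
  exists2 Z, cond_exp_ge0 Y Z & {ae P, forall w, (Z w < +oo)%E}.

(* E(Y | G) = Z almost surely, for a real Y. As Y is only required to be
   integrable conditionally on G, and not under P, the conditional expectation
   is E(Y^+ | G) - E(Y^- | G), both terms being almost surely finite. *)
Definition cond_exp_eq (Y Z : Omega -> R) : Prop :=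
  exists Zp Zn : Omega -> \bar R,
    [/\ cond_exp_ge0 (fun w => (Num.max (Y w) 0)%:E) Zp,
        cond_exp_ge0 (fun w => (Num.max (- Y w) 0)%:E) Zn,
        {ae P, forall w, (Zp w < +oo)%E},
        {ae P, forall w, (Zn w < +oo)%E} &
        {ae P, forall w, ((Z w)%:E = Zp w - Zn w)%E}].

(* Convergence in L^2 under the conditional law given G: the Y_M and Y are
   conditionally square integrable, and E(|Y_M - Y|^2 | G) tends to 0 a.s. *)
Definition cond_cvg_L2 (p : nat) (YM : nat -> Omega -> 'cV[R]_p)
    (Y : Omega -> 'cV[R]_p) : Prop :=
  [/\ forall M, cond_exp_finite (fun w => (sqnorm (YM M w))%:E),
      cond_exp_finite (fun w => (sqnorm (Y w))%:E) &
      exists2 Z : nat -> Omega -> \bar R,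
        forall M, cond_exp_ge0 (fun w => (sqnorm (YM M w - Y w))%:E) (Z M) &
        {ae P, forall w, Z ^~ w @ \oo --> 0%E}].

End conditional_expectation.

Section parametric_model.
Context {d : measure_display} {T : measurableType d} {R : realType} {p : nat}.
Variables (mu : {measure set T -> \bar R}) (Theta : set 'cV[R]_p).
Variable f : T -> 'cV[R]_p -> R.

(* f x theta stands for p(x | theta), a density with respect to mu. Its values
   for theta outside Theta are unconstrained. *)
Definition is_model : Prop := forall theta, Theta theta ->
  [/\ measurable_fun [set: T] (f ^~ theta),
      forall x, 0 <= f x theta &
      (\int[mu]_x (f x theta)%:E = 1)%E].

Definition score (x : T) (theta : 'cV[R]_p) : 'cV[R]_p :=
  \col_j 'D_(delta_mx j 0) (fun t => ln (f x t)) theta.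

(* The gradient defining the score exists at the points of the support of the
   density, up to a mu-null set. *)
Definition has_score : Prop := forall theta, Theta theta ->
  {ae mu, forall x, 0 < f x theta ->
    forall j, derivable (fun t => ln (f x t)) theta (delta_mx j 0)}.

Definition is_mle (n : nat) (x : 'I_n -> T) (theta : 'cV[R]_p) : Prop :=
  Theta theta /\
  forall t, Theta t -> \prod_(i < n) f (x i) t <= \prod_(i < n) f (x i) theta.

End parametric_model.

Section predictive_recursion.
Context {dT dO : measure_display} {T : measurableType dT}.
Context {Omega : measurableType dO} {R : realType} {p n : nat}.
Variable f : T -> 'cV[R]_p -> R.
Variable X : 'I_n -> Omega -> T.
(* Xt m is the generated observation of index n + m, for m >= 1; Xt 0 is not
   used. *)
Variable Xt : nat -> Omega -> T.
Variable est : ('I_n -> T) -> 'cV[R]_p.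

(* The sigma-algebra generated by X_1, ..., X_n and by the first m generated
   observations; for m = 0 it is the one generated by the data. *)
Definition filtr (m : nat) : set (set Omega) :=
  <<s [set B | exists A : set T, measurable A /\
        ((exists i : 'I_n, B = X i @^-1` A) \/
         (exists2 k, (1 <= k <= m)%N & B = Xt k @^-1` A))] >>.

Definition gain (m : nat) : R := (n + m)%:R^-1.

Fixpoint thetas (m : nat) (w : Omega) : 'cV[R]_p :=
  match m with
  | 0 => est (X ^~ w)
  | m'.+1 => thetas m' w + gain m *: score f (Xt m w) (thetas m' w)
  end.

Definition scores (m : nat) (w : Omega) : 'cV[R]_p :=
  score f (Xt m w) (thetas m.-1 w).

Definition Dsum (M : nat) (w : Omega) : 'cV[R]_p :=
  \sum_(1 <= m < M.+1) gain m *: scores m w.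

Definition Qsum (M : nat) (w : Omega) : 'M[R]_p :=
  \sum_(1 <= m < M.+1) gain m ^+ 2 *: (scores m w *m (scores m w)^T).

Definition wsum (M : nat) : R := \sum_(1 <= m < M.+1) gain m ^+ 2.

Definition winf : R := limn wsum.

Definition Ipath (M : nat) (w : Omega) : 'M[R]_p := (wsum M)^-1 *: Qsum M w.

Definition theta_pc (M : nat) (w : Omega) : 'cV[R]_p :=
  thetas 0 w + invmx (Ipath M w) *m Dsum M w.

(* Given the past up to step m - 1, the m-th generated observation is drawn
   from p(. | theta_{m-1}): for each A, the integral of this density over A is
   a.s. equal to a version of the conditional probability that Xt m is in A. *)
Definition predictive_law (P : probability Omega R)
    (mu : {measure set T -> \bar R}) : Prop :=
  forall m, (1 <= m)%N -> forall A : set T, measurable A ->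
  exists2 Z : Omega -> \bar R,
    cond_exp_ge0 P (filtr m.-1) (fun w => (\1_A (Xt m w))%:E) Z &
    {ae P, forall w, (Z w = \int[mu]_(x in A) (f x (thetas m.-1 w))%:E)%E}.

Definition measurable_wrt (G : set (set Omega)) (Y : Omega -> 'cV[R]_p) :=
  forall j (B : set R), measurable B -> G ((fun w => Y w j 0) @^-1` B).

End predictive_recursion.

Arguments gain {R} n m.
Arguments wsum {R} n M.
Arguments winf {R} n.

(* Main.v *)
From HB Require Import structures.
Require Import Defs.
From mathcomp Require Import ring lra.

Set Implicit Arguments.
Unset Strict Implicit.
Unset Printing Implicit Defensive.

Local Open Scope classical_set_scope.
Local Open Scope ring_scope.

(** Let Z be a finite version of E(sum_m gamma_m^2 |s_m|^2 | F_0). On a set B of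
    F_0 included in {Z <= k}, the terms 1_B gamma_m s_m are genuinely square
    integrable martingale differences, so the coordinates of D_M converge almost
    surely on B by Kolmogorov's maximal inequality; these sets cover almost all
    of the sample space. By orthogonality and Fatou's lemma, the integral of
    |D_M - D_oo|^2 over B is at most that of
    T_M = sum_{m > M} E(gamma_m^2 |s_m|^2 | F_0). Hence
    E(|D_M - D_oo|^2 | F_0) <= T_M almost surely, and T_M tends to 0 as the tail
    of a convergent series. The conditional expectations given F_0 are obtained
    from the Radon-Nikodym theorem on the sub-sigma-algebra. *)

(** * Limits of matrices and sums of squared gains *)

Section matrix_limits.
Context {R : realType}.

(** Reduces every matrix limit below to scalar ones. The index set is finite, so the neighbourhoods
    of the entries can be intersected. *)
Lemma mx_cvgP m n {T : Type} (F : set_system T) {FF : Filter F}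
    (u : T -> 'M[R]_(m, n)) (A : 'M[R]_(m, n)) :
  u @ F --> A <-> forall i j, (fun t => u t i j) @ F --> A i j.
Proof.
split=> [uA i j|uA].
  apply: (@cvg_comp _ _ _ u (fun M : 'M[R]_(m, n) => M i j) _ (nbhs A)) => //.
  exact: coord_continuous.
apply/cvg_ballP => e e0.
suff : \forall t \near F, forall ij : 'I_m * 'I_n,
    ball (A ij.1 ij.2) e (u t ij.1 ij.2).
  by apply: filterS => t h; split => // i j; exact: (h (i, j)).
apply: filter_forall => -[i j] /=.
by have /cvg_ballP := uA i j; exact.
Qed.

(** By the Leibniz formula the determinant is a polynomial in the entries. *)
Lemma cvg_det n {T : Type} (F : set_system T) {FF : Filter F}
    (u : T -> 'M[R]_n) (A : 'M[R]_n) :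
  u @ F --> A -> (fun t => \det (u t)) @ F --> \det A.
Proof.
move=> /mx_cvgP uA; rewrite /determinant.
apply: cvg_big => [|s _].
  exact: (@pseudometric_normed_Zmodule.add_continuous R R^o).
apply: cvgMr.
by apply: cvg_big => [|i _]; [exact: mul_continuous|]; exact: uA.
Qed.

Lemma cvg_adj n {T : Type} (F : set_system T) {FF : Filter F}
    (u : T -> 'M[R]_n) (A : 'M[R]_n) :
  u @ F --> A -> (fun t => \adj (u t)) @ F --> \adj A.
Proof.
move=> /mx_cvgP uA; apply/mx_cvgP => i j; rewrite mxE /cofactor.
under eq_fun do rewrite mxE /cofactor.
apply: cvgMr; apply: cvg_det; apply/mx_cvgP => k l.
by under eq_fun do rewrite !mxE; rewrite !mxE; exact: uA.
Qed.

Lemma cvg_mulmx m n p {T : Type} (F : set_system T) {FF : Filter F}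
    (u : T -> 'M[R]_(m, n)) (v : T -> 'M[R]_(n, p))
    (A : 'M[R]_(m, n)) (B : 'M[R]_(n, p)) :
  u @ F --> A -> v @ F --> B -> (fun t => u t *m v t) @ F --> A *m B.
Proof.
move=> /mx_cvgP uA /mx_cvgP vB; apply/mx_cvgP => i j; rewrite mxE.
under eq_fun do rewrite mxE.
by apply: cvg_big => [|k _];
  [exact: (@pseudometric_normed_Zmodule.add_continuous R R^o)|]; exact: cvgM.
Qed.

Lemma near_unitmx n {T : Type} (F : set_system T) {FF : Filter F}
    (u : T -> 'M[R]_n) (A : 'M[R]_n) :
  u @ F --> A -> A \in unitmx -> \forall t \near F, u t \in unitmx.
Proof.
move=> /cvg_det uA; rewrite unitmxE unitfE => A0.
have : \forall t \near F, \det (u t) != 0.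
  by apply: (uA [set x | x != 0]); apply: open_nbhs_nbhs; split => //;
    exact: open_neq.
by apply: filterS => t; rewrite unitmxE unitfE.
Qed.

(** Cramer's formula expresses the inverse through the adjugate and the determinant, both
    continuous, with a nonzero limit determinant. *)
Lemma cvg_invmx n {T : Type} (F : set_system T) {FF : Filter F}
    (u : T -> 'M[R]_n) (A : 'M[R]_n) :
  u @ F --> A -> A \in unitmx -> (fun t => invmx (u t)) @ F --> invmx A.
Proof.
move=> uA Au.
have Ad : \det A != 0 by rewrite -unitfE -unitmxE.
have h : (fun t => (\det (u t))^-1 *: \adj (u t)) @ F --> invmx A.
  rewrite /invmx Au; have /mx_cvgP aA :
    (fun t => \adj (u t)) @ F --> \adj A by exact: cvg_adj.
  apply/mx_cvgP => i j; rewrite mxE; under eq_fun do rewrite mxE.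
  by apply: cvgM => //; apply: cvgV => //; exact: cvg_det.
(* [invmx] returns its argument unchanged on a singular matrix, so Cramer's formula holds only
   eventually along [F]. *)
apply: cvg_trans h; apply: near_eq_cvg.
by apply: filterS (near_unitmx uA Au) => t ut; rewrite /invmx ut.
Qed.

(** A nonzero row vector killed by [A] would make the quadratic form vanish at its transpose. *)
Lemma posdefmx_unit n (A : 'M[R]_n) : posdefmx A -> A \in unitmx.
Proof.
move=> [As Ap]; rewrite unitmxE unitfE; apply/negP => /det0P [v v0 vA].
have : v^T != 0 by rewrite -trmx0 (inj_eq (@trmx_inj _ _ _)).
by move=> /Ap; rewrite trmxK vA mul0mx mxE ltxx.
Qed.

End matrix_limits.

(** * Summability of the squared gains *)

Section squared_gains.
Context {R : realType} (n : nat).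
Hypothesis n_gt0 : (0 < n)%N.

Lemma gain_gt0 m : 0 < gain n m :> R.
Proof. by rewrite /gain invr_gt0 ltr0n addn_gt0 n_gt0. Qed.

Lemma wsum_nd : {homo @wsum R n : M N / (M <= N)%N >-> M <= N}.
Proof.
apply/nondecreasing_seqP => M; rewrite /wsum.
by rewrite [leRHS]big_nat_recr//= lerDl sqr_ge0.
Qed.

(* Telescoping: gain m ^ 2 <= gain m.-1 - gain m. *)
Lemma wsum_le M : wsum n M <= n%:R^-1 - gain n M :> R.
Proof.
elim: M => [|M ih].
  by rewrite /wsum big_geq// /gain addn0 subrr.
rewrite /wsum big_nat_recr//= -/(wsum n M).
apply: le_trans (lerD ih (lexx _)) _.
rewrite -addrA lerD2l -lerBrDl opprK /gain addnS.
have a0 : 0 < (n + M)%:R :> R by rewrite ltr0n addn_gt0 n_gt0.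
rewrite -(natr1 (n + M)%N); move: (n + M)%:R a0 => a a0.
have a1 : 0 < a + 1 by rewrite addr_gt0.
rewrite -subr_ge0.
(* The slack in the telescoping bound, with [a] standing for [n + M]. *)
have -> : - (a + 1)^-1 + a^-1 - (a + 1)^-1 ^+ 2 = (a * (a + 1) ^+ 2)^-1.
  by field; rewrite !gt_eqF.
by rewrite invr_ge0 mulr_ge0 ?ltW// exprn_gt0.
Qed.

Lemma cvg_wsum : @wsum R n @ \oo --> winf n.
Proof.
apply: nondecreasing_is_cvgn; first exact: wsum_nd.
exists n%:R^-1 => _ [M _ <-]; apply: (le_trans (wsum_le M)).
by rewrite gerBl ltW// gain_gt0.
Qed.

Lemma winf_gt0 : 0 < winf n :> R.
Proof.
have h : wsum n 1 <= winf n :> R.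
  apply: nondecreasing_cvgn_le; first exact: wsum_nd.
  by apply/cvg_ex; eexists; exact: cvg_wsum.
apply: lt_le_trans h.
by rewrite /wsum big_nat1 exprn_gt0// gain_gt0.
Qed.

End squared_gains.

(** * Conditional expectation of nonnegative functions *)

Section sub_sigma_algebra.
Context {d : measure_display} {Omega : measurableType d} {R : realType}.
Variables (P : probability Omega R) (G : set (set Omega)).
Hypothesis sG : <<s G>> `<=` measurable.

Lemma sub_measurable_fun d' (U : measurableType d') (f : Omega -> U) :
  measurable_fun [set: g_sigma_algebraType G] f ->
    measurable_fun [set: Omega] f.
Proof. by move=> mf _ B mB; apply: sG; exact: mf. Qed.

Lemma integral_mulr_indic (A : set Omega) (f : Omega -> \bar R) :
  (\int[P]_w (f w * (\1_A w)%:E) = \int[P]_(w in A) f w)%E.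
Proof.
rewrite [RHS]integral_mkcond; apply: eq_integral => w _ /=.
by rewrite patchE indicE; case: ifP => _; rewrite ?mule1 ?mule0.
Qed.

Section same_integrals.
Import HBNNSimple.
Variables f g : Omega -> R.
Hypotheses (mf : measurable_fun [set: Omega] f)
  (mg : measurable_fun [set: Omega] g).
Hypotheses (f0 : forall w, 0 <= f w) (g0 : forall w, 0 <= g w).
Hypothesis fg : forall A, <<s G>> A ->
  (\int[P]_(w in A) (f w)%:E = \int[P]_(w in A) (g w)%:E)%E.

(** The level sets of [h] lie in the sub-sigma-algebra, so the right-hand side sees [k] only through
    its integrals over such sets. It therefore takes the same value for [f] and for [g]. *)
Lemma integral_mul_nnsfun (h : {nnsfun g_sigma_algebraType G >-> R})
    (k : Omega -> R) : measurable_fun [set: Omega] k ->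
  (forall w, 0 <= k w) ->
  (\int[P]_w (k w * h w)%:E =
   \sum_(y \in range h) (y%:E * \int[P]_(w in h @^-1` [set y]) (k w)%:E))%E.
Proof.
move=> mk k0.
have mh y : measurable (h @^-1` [set y] : set Omega).
  by apply: sG; exact: (measurable_sfunP h (measurable_set1 y)).
transitivity (\int[P]_w
    (\sum_(y \in range h) ((k w)%:E * (y * \1_(h @^-1` [set y]) w)%:E)))%E.
  apply: eq_integral => w _.
  rewrite EFinM (fimfunE h) -fsumEFin// ge0_mule_fsumr// => y.
  by rewrite EFinM nnfun_muleindic_ge0.
rewrite ge0_integral_fsum//=; last 2 first.
- move=> y; apply: emeasurable_funM; first exact/measurable_EFinP.
  apply/measurable_EFinP.
  by apply: measurable_funM => //; exact: measurable_indic.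
- move=> y w _; apply: mule_ge0; first by rewrite lee_fin.
  by rewrite EFinM nnfun_muleindic_ge0.
apply: eq_fsbigr => y /set_mem [w _ <-].
rewrite -ge0_integralZl//=; last 3 first.
- by apply/measurable_EFinP; exact: measurable_funTS.
- by move=> x _; rewrite lee_fin.
- by rewrite lee_fin.
rewrite -[RHS]integral_mulr_indic.
by apply: eq_integral => x _; rewrite EFinM muleCA -muleA.
Qed.

(** Monotone convergence along simple approximations of [Y] measurable for the sub-sigma-algebra.
    Both sides may be infinite. *)
Lemma eq_integral_mulr (Y : Omega -> R) :
  measurable_fun [set: g_sigma_algebraType G] Y -> (forall w, 0 <= Y w) ->
  (\int[P]_w (f w * Y w)%:E = \int[P]_w (g w * Y w)%:E)%E.
Proof.
move=> mY Y0.
have mEY : measurable_fun [set: g_sigma_algebraType G] (EFin \o Y).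
  exact/measurable_EFinP.
pose h := nnsfun_approx measurableT mEY.
have mh n : measurable_fun [set: Omega] (EFin \o h n).
  apply/measurable_EFinP; apply: sub_measurable_fun;
    exact: (measurable_funPT (h n)).
have hY w : (h n w)%:E @[n --> \oo] --> (Y w)%:E.
  by apply: (cvg_nnsfun_approx measurableT mEY) => //= x _; rewrite lee_fin.
have lim_h (k : Omega -> R) : measurable_fun [set: Omega] k ->
    (forall w, 0 <= k w) ->
  (\int[P]_w (k w * Y w)%:E = limn (fun n => \int[P]_w (k w * h n w)%:E))%E.
  move=> mk k0; rewrite -monotone_convergence//.
  - apply: eq_integral => w _; apply/esym/cvg_lim => //.
    under eq_fun do rewrite EFinM; rewrite EFinM.
    exact: cvgeZl.
  - by move=> n; apply/measurable_EFinP; apply: measurable_funM => //;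
      exact/measurable_EFinP/mh.
  - by move=> n w _; rewrite lee_fin mulr_ge0.
  - move=> w _ m n mn; rewrite lee_fin ler_wpM2l//.
    by have /lefP := nd_nnsfun_approx measurableT mEY mn; exact.
rewrite !lim_h//; congr (limn _); apply/funext => n.
rewrite !integral_mul_nnsfun//; apply: eq_fsbigr => y _; congr (_ * _)%E.
by apply: fg; exact: (measurable_sfunP (h n) (measurable_set1 y)).
Qed.

End same_integrals.

(** The identity, read as a map onto the coarser measurable space. Pushing [P] forward along it
    restricts [P] to the sub-sigma-algebra. *)
Definition to_sub : Omega -> g_sigma_algebraType G := id.

Lemma measurable_to_sub : measurable_fun [set: Omega] to_sub.
Proof. by move=> _ B mB; rewrite setTI; exact: sG. Qed.

Definition sub_prob := pushforward P to_sub.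

Let sub_prob0 : sub_prob set0 = 0%E.
Proof. exact: (measure0 P). Qed.

Let sub_prob_ge0 A : (0 <= sub_prob A)%E.
Proof. exact: (measure_ge0 P). Qed.

Let sub_prob_sigma_additive : semi_sigma_additive sub_prob.
Proof.
move=> F mF tF mUF.
exact: (@measure_semi_sigma_additive _ _ _ P F (fun i => sG (mF i)) tF (sG
  mUF)).
Qed.

HB.instance Definition _ := isMeasure.Build _ _ _ sub_prob
  sub_prob0 sub_prob_ge0 sub_prob_sigma_additive.

Let sub_prob_fin : fin_num_fun sub_prob.
Proof. by move=> A mA; exact/fin_num_measure/sG. Qed.

HB.instance Definition _ := @Measure_isFinite.Build _ _ _ sub_prob sub_prob_fin.

Section integral_measure.
Variable f : Omega -> \bar R.
Hypotheses (f0 : forall w, (0 <= f w)%E) (mf : measurable_fun [set: Omega] f).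
Hypothesis fi : (\int[P]_w f w < +oo)%E.

(** The measure with density [f] with respect to [P], restricted to the sub-sigma-algebra. Since [f]
    need not be measurable there, its density with respect to [sub_prob] is a different function:
    the conditional expectation of [f]. *)
Definition integral_measure (A : set (g_sigma_algebraType G)) : \bar R :=
  (\int[P]_(w in A) f w)%E.

Let integral_measure0 : integral_measure set0 = 0%E.
Proof. exact: integral_set0. Qed.

Let integral_measure_ge0 A : (0 <= integral_measure A)%E.
Proof. exact: integral_ge0. Qed.

Let integral_measure_sigma_additive : semi_sigma_additive integral_measure.
Proof.
move=> F mF tF mUF; exact: (semi_sigma_additive_nng_induced mf f0 (fun i => sG
  (mF i)) tF (sG mUF)).
Qed.

HB.instance Definition _ := isMeasure.Build _ _ _ integral_measure
  integral_measure0 integral_measure_ge0 integral_measure_sigma_additive.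

Let integral_measure_fin : fin_num_fun integral_measure.
Proof.
move=> A mA; rewrite ge0_fin_numE//; apply: le_lt_trans fi.
by apply: ge0_subset_integral => //; exact: sG.
Qed.

HB.instance Definition _ := @Measure_isFinite.Build _ _ _ integral_measure
  integral_measure_fin.

Lemma cond_exp_ge0_integrable : exists Z, cond_exp_ge0 P <<s G>> f Z.
Proof.
have dom : integral_measure `<< sub_prob.
  apply/null_content_dominatesP => A mA PA0.
  by apply: null_set_integral => //; [exact: sG|exact: measurable_funTS].
have [Z [Z0 /measurable_int mZ Zf]] := radon_nikodym_finite dom.
exists Z; split => //.
  by move=> B mB; rewrite -[X in <<s G>> X]setTI; exact: mZ.
move=> A mA; rewrite -[RHS]/(integral_measure A) Zf//.
by rewrite (ge0_integral_pushforward measurable_to_sub)//;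
  exact: measurable_funTS.
Qed.

End integral_measure.

(** Without integrability the Radon-Nikodym theorem does not apply to [f] directly. Cutting [f]
    according to its integer part gives bounded slices, and the conditional expectations of the
    slices are summed. *)
Lemma cond_exp_ge0_exists (f : Omega -> R) :
  (forall w, 0 <= f w) -> measurable_fun [set: Omega] f ->
  exists Z, cond_exp_ge0 P <<s G>> (EFin \o f) Z.
Proof.
move=> f0 mf.
pose B k := f @^-1` `[k%:R, k.+1%:R[.
have mB k : measurable (B k) by rewrite -[B k]setTI; exact: mf.
pose h k w := (f w * \1_(B k) w)%:E.
have h0 k w : (0 <= h k w)%E by rewrite lee_fin mulr_ge0.
have mh k : measurable_fun [set: Omega] (h k).
  by apply/measurable_EFinP; apply: measurable_funM => //;
    exact: measurable_indic.
have hfin k : (\int[P]_w h k w < +oo)%E.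
  apply: (@le_lt_trans _ _ (\int[P]_w (cst k.+1%:R%:E) w))%E.
    apply: ge0_le_integral => //.
    move=> w _; rewrite lee_fin indicE;
      case: (boolP (w \in B k)) => [/set_mem|_].
      by rewrite /B/= in_itv/= mulr1 => /andP[_ /ltW].
    by rewrite mulr0.
  rewrite integral_cst// ltey_eq fin_numM//; exact: fin_num_measure.
have /choice [Z Zh] : forall k, exists Z, cond_exp_ge0 P <<s G>> (h k) Z.
  by move=> k; exact: cond_exp_ge0_integrable.
have Z0 k w : (0 <= Z k w)%E by have [+ _ _] := Zh k; exact.
have mZ k : measurable_fun [set: g_sigma_algebraType G] (Z k).
  by move=> _ A mA; rewrite setTI; have [_ + _] := Zh k; exact.
(* Only the slice of index [Num.truncn (f w)] can be nonzero at [w], so the partial sums are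
   eventually constant. *)
have fE w : (EFin \o f) w = (\sum_(k <oo) h k w)%E.
  apply/esym/cvg_lim => //; apply: cvg_near_cst; near=> N.
  have kN : (Num.truncn (f w) < N)%N by near: N; exact: nbhs_infty_gt.
  rewrite big_mkord (bigD1 (Ordinal kN))//= big1 ?adde0 => [|[i iN] /= ik].
    rewrite /h indicE mem_set ?mulr1//= /B/= in_itv/=.
    by have := truncn_itv (f0 w).
  rewrite /h indicE memNset ?mulr0// /B/= in_itv/= => /truncn_def tE.
  by move: ik; rewrite -val_eqE/= tE eqxx.
exists (fun w => \sum_(k <oo) Z k w)%E; split.
- by move=> w; exact: nneseries_ge0.
- move=> A mA; rewrite -[X in <<s G>> X]setTI.
  have : measurable_fun [set: g_sigma_algebraType G] (fun w => \sum_(k <oo) Z k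
    w)%E.
    exact: ge0_emeasurable_sum.
  exact.
- move=> A mA; under [RHS]eq_integral do rewrite fE.
  rewrite !integral_nneseries//; last 4 first.
  + exact: sG.
  + by move=> k; apply: measurable_funTS; exact: mh.
  + exact: sG.
  + by move=> k; apply/measurable_funTS/sub_measurable_fun.
  by apply: eq_eseriesr => k _; have [_ _] := Zh k; exact.
Unshelve. all: by end_near. Qed.

(** On the part [B] of [A] where [T < Z], the positive function [Z - T] has integral at most 0, so
    [B] is negligible. Finiteness of the integral of [T] over [A] allows the integrals to be
    subtracted. *)
Lemma ae_le_integral (A : set Omega) (Z T : Omega -> \bar R) : <<s G>> A ->
  measurable_fun [set: g_sigma_algebraType G] Z ->
  measurable_fun [set: g_sigma_algebraType G] T ->
  (forall w, 0 <= Z w)%E -> (forall w, 0 <= T w)%E ->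
  (forall B, <<s G>> B -> B `<=` A ->
    \int[P]_(w in B) Z w <= \int[P]_(w in B) T w)%E ->
  (\int[P]_(w in A) T w < +oo)%E ->
  {ae P, forall w, A w -> (Z w <= T w)%E}.
Proof.
move=> GA mZ mT Z0 T0 ZT Tfin.
pose B := A `&` [set w | (T w < Z w)%E].
have GB : <<s G>> B.
  by apply: (@emeasurable_fun_lt _ (g_sigma_algebraType G)) => //;
    exact: measurable_funTS.
have mB : measurable B := sG GB.
have mZB : measurable_fun B Z by apply/measurable_funTS/sub_measurable_fun.
have mTB : measurable_fun B T by apply/measurable_funTS/sub_measurable_fun.
have TBfin : (\int[P]_(w in B) T w < +oo)%E.
  apply: le_lt_trans Tfin; apply: ge0_subset_integral => //.
  - exact: sG.
  - by apply/measurable_funTS/sub_measurable_fun.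
  - by move=> w [].
have TB : P.-integrable B T.
  apply/integrableP; split => //.
  by rewrite (eq_integral T); [exact: TBfin|move=> w _; rewrite gee0_abs].
have ZB : P.-integrable B Z.
  apply/integrableP; split => //.
  rewrite (eq_integral Z); last by move=> w _; rewrite gee0_abs.
  by apply: le_lt_trans TBfin; apply: ZT => // w [].
have ZTB : (\int[P]_(w in B) `|Z w - T w| = 0)%E.
  transitivity (\int[P]_(w in B) (Z w - T w))%E.
    by apply: eq_integral => w /set_mem [_ TZ];
      rewrite gee0_abs// ltW// sube_gt0.
  rewrite integralB//; apply/eqP; rewrite eq_le sube_le0 ZT//=;
    last by move=> w [].
  rewrite suber_ge0 ?integrable_fin_num//.
  by apply: ge0_le_integral => // w [_ /ltW].
have : ae_eq P B (fun w => Z w - T w)%E (cst 0%E).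
  by apply/ae_eq_integral_abs => //; exact: emeasurable_funB.
apply: filterS => w h Aw; rewrite leNgt; apply/negP => TZ.
have /= /eqP := h (conj Aw TZ).
by rewrite gt_eqF// sube_gt0.
Qed.

Lemma cond_exp_ge0_measurable (Y Z : Omega -> \bar R) :
  cond_exp_ge0 P <<s G>> Y Z -> measurable_fun [set: g_sigma_algebraType G] Z.
Proof. by move=> [_ mZ _] _ B mB; rewrite setTI; exact: mZ. Qed.

(** The comparison is made separately on each [A k], where [T] is integrable. Countably many
    exceptional null sets are then discarded. *)
Lemma cond_exp_dominated (A : nat -> set Omega) (Y : Omega -> R)
    (T : Omega -> \bar R) :
  (forall k, <<s G>> (A k)) -> {ae P, forall w, exists k, A k w} ->
  (forall w, 0 <= Y w) -> measurable_fun [set: Omega] Y ->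
  (forall w, 0 <= T w)%E -> measurable_fun [set: g_sigma_algebraType G] T ->
  (forall k, \int[P]_(w in A k) T w < +oo)%E ->
  (forall k B, <<s G>> B -> B `<=` A k ->
    \int[P]_(w in B) (Y w)%:E <= \int[P]_(w in B) T w)%E ->
  exists2 Z, cond_exp_ge0 P <<s G>> (EFin \o Y) Z &
    {ae P, forall w, (Z w <= T w)%E}.
Proof.
move=> GA cover Y0 mY T0 mT Tfin YT.
have [Z Zh] := cond_exp_ge0_exists Y0 mY.
exists Z => //; have [Z0 _ ZY] := Zh.
have h k : {ae P, forall w, A k w -> (Z w <= T w)%E}.
  apply: ae_le_integral => //; first exact: cond_exp_ge0_measurable Zh.
  by move=> B GB BA; rewrite ZY//; exact: YT BA.
by apply: filterS2 (ae_foralln h) cover => w hw [k /hw].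
Qed.

Lemma integral_lty_ae_fin (A : nat -> set Omega) (T : Omega -> \bar R) :
  (forall k, <<s G>> (A k)) -> {ae P, forall w, exists k, A k w} ->
  (forall w, 0 <= T w)%E -> measurable_fun [set: g_sigma_algebraType G] T ->
  (forall k, \int[P]_(w in A k) T w < +oo)%E ->
  {ae P, forall w, (T w < +oo)%E}.
Proof.
move=> GA cover T0 mT Tfin.
have h k : {ae P, forall w, A k w -> T w \is a fin_num}.
  have mA : measurable (A k) by exact: sG.
  apply: integrable_ae => //; apply/integrableP; split.
    exact/measurable_funTS/sub_measurable_fun.
  by rewrite (eq_integral T) => [|w _]; [exact: Tfin|rewrite gee0_abs].
apply: filterS2 (ae_foralln h) cover => w hw [k /hw].
by rewrite ge0_fin_numE.
Qed.

(* The integrals on both sides of the hypothesis may be infinite. *)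
Lemma centered_orthogonal (x W : Omega -> R) :
  measurable_fun [set: Omega] x ->
  (forall A, <<s G>> A -> \int[P]_(w in A) (Num.max (x w) 0)%:E =
                          \int[P]_(w in A) (Num.max (- x w) 0)%:E)%E ->
  measurable_fun [set: g_sigma_algebraType G] W ->
  P.-integrable [set: Omega] (fun w => (x w * W w)%:E) ->
  (\int[P]_w (x w * W w)%:E = 0)%E.
Proof.
move=> mx x0 mW iW.
(* [eq_integral_mulr] concerns nonnegative factors, so [x] and [W] are both split into positive and
   negative parts. Each of the four products is dominated by the absolute value of [x * W], hence
   integrable, and they cancel in pairs. *)
pose xp w := Num.max (x w) 0; pose xn w := Num.max (- x w) 0.
pose Wp w := Num.max (W w) 0; pose Wn w := Num.max (- W w) 0.
have mxp : measurable_fun [set: Omega] xp by exact: measurable_maxr.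
have mxn : measurable_fun [set: Omega] xn.
  by apply: measurable_maxr => //; exact: measurableT_comp.
have mWp : measurable_fun [set: g_sigma_algebraType G] Wp by exact:
  measurable_maxr.
have mWn : measurable_fun [set: g_sigma_algebraType G] Wn.
  by apply: measurable_maxr => //; exact: measurableT_comp.
have xp0 w : 0 <= xp w by rewrite /xp le_max lexx orbT.
have xn0 w : 0 <= xn w by rewrite /xn le_max lexx orbT.
have Wp0 w : 0 <= Wp w by rewrite /Wp le_max lexx orbT.
have Wn0 w : 0 <= Wn w by rewrite /Wn le_max lexx orbT.
have eWp := eq_integral_mulr mxp mxn xp0 xn0 x0 mWp Wp0.
have eWn := eq_integral_mulr mxp mxn xp0 xn0 x0 mWn Wn0.
have maxle (a : R) : Num.max a 0 <= `|a| by rewrite ge_max ler_norm normr_ge0.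
have int (a b : Omega -> R) : measurable_fun [set: Omega] a ->
    measurable_fun [set: Omega] b -> (forall w, 0 <= a w <= `|x w|) ->
    (forall w, 0 <= b w <= `|W w|) ->
    P.-integrable [set: Omega] (fun w => (a w * b w)%:E).
  move=> ma mb ha hb; apply: le_integrable iW => //.
    by apply/measurable_EFinP; exact: measurable_funM.
  move=> w _; have /andP[a0 ax] := ha w; have /andP[b0 bW] := hb w.
  by rewrite /= lee_fin !normrM ler_pM ?normr_ge0// ger0_norm.
have mWp' := sub_measurable_fun mWp; have mWn' := sub_measurable_fun mWn.
have hxp w : 0 <= xp w <= `|x w| by rewrite xp0 maxle.
have hxn w : 0 <= xn w <= `|x w| by rewrite xn0 -normrN maxle.
have hWp w : 0 <= Wp w <= `|W w| by rewrite Wp0 maxle.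
have hWn w : 0 <= Wn w <= `|W w| by rewrite Wn0 -normrN maxle.
have ipp := int _ _ mxp mWp' hxp hWp.
have inp := int _ _ mxn mWp' hxn hWp.
have ipn := int _ _ mxp mWn' hxp hWn.
have inn := int _ _ mxn mWn' hxn hWn.
have posneg (a : R) : a = Num.max a 0 - Num.max (- a) 0.
  have [a0|/ltW a0] := leP 0 a.
    by rewrite (max_idPr _) ?subr0// oppr_le0.
  by rewrite (max_idPl _) ?sub0r ?opprK// oppr_ge0.
transitivity (\int[P]_w (((xp w * Wp w)%:E - (xn w * Wp w)%:E) -
    ((xp w * Wn w)%:E - (xn w * Wn w)%:E)))%E.
  apply: eq_integral => w _; rewrite -!EFinB; congr EFin.
  by rewrite [in LHS](posneg (x w)) [in LHS](posneg (W w)) /xp /xn /Wp /Wn;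
    ring.
rewrite integralB//; [|exact: integrableB..].
rewrite !integralB// eWp eWn !subee ?adde0// ?oppe0 ?adde0//;
  exact: integrable_fin_num.
Qed.

End sub_sigma_algebra.

(** * Square integrable martingale differences *)

Section square_integrable.
Context {d : measure_display} {Omega : measurableType d} {R : realType}.
Variable P : probability Omega R.

Definition square_integrable (x : Omega -> R) :=
  measurable_fun [set: Omega] x /\
  P.-integrable [set: Omega] (fun w => (x w ^+ 2)%:E).

Lemma square_integrableP (x : Omega -> R) : measurable_fun [set: Omega] x ->
  (\int[P]_w (x w ^+ 2)%:E < +oo)%E -> square_integrable x.
Proof.
move=> mx x2; split=> //; apply/integrableP; split.
  by apply/measurable_EFinP; exact: measurable_funX.
rewrite (eq_integral (fun w => (x w ^+ 2)%:E)) => [|w _]; first exact: x2.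
by rewrite gee0_abs// lee_fin sqr_ge0.
Qed.

Lemma square_integrable_le (x y : Omega -> R) : measurable_fun [set: Omega] x ->
  (forall w, x w ^+ 2 <= y w ^+ 2) -> square_integrable y ->
    square_integrable x.
Proof.
move=> mx xy [my y2]; split => //; apply: le_integrable y2 => //.
  by apply/measurable_EFinP; exact: measurable_funX.
by move=> w _; rewrite /= lee_fin !ger0_norm ?sqr_ge0.
Qed.

Lemma integrable_mul (x y : Omega -> R) : square_integrable x ->
  square_integrable y -> P.-integrable [set: Omega] (fun w => (x w * y w)%:E).
Proof.
move=> [mx x2] [my y2].
apply: le_integrable (integrableD measurableT x2 y2) => //.
  by apply/measurable_EFinP; exact: measurable_funM.
move=> w _; rewrite /= lee_fin [leRHS]ger0_norm ?addr_ge0 ?sqr_ge0//.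
by rewrite ler_norml; apply/andP; split; nra.
Qed.

Lemma square_integrableD (x y : Omega -> R) : square_integrable x ->
  square_integrable y -> square_integrable (fun w => x w + y w).
Proof.
move=> sx sy; have [mx x2] := sx; have [my y2] := sy.
split; first exact: measurable_funD.
rewrite (_ : (fun w => _) =
  ((fun w => (x w ^+ 2)%:E) \+ (fun w => (x w * y w)%:E)) \+
  ((fun w => (x w * y w)%:E) \+ (fun w => (y w ^+ 2)%:E)))%E; last first.
  by apply/funext => w /=; rewrite -!EFinD; congr EFin; ring.
have xy := integrable_mul sx sy.
by apply: integrableD => //; exact: integrableD.
Qed.

Lemma square_integrable0 : square_integrable (fun=> 0).
Proof.
apply: square_integrableP => //.
by under eq_integral do rewrite expr0n/=; rewrite integral0.
Qed.

Lemma square_integrable_indic (x : Omega -> R) (A : set Omega) : measurable A ->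
  square_integrable x -> square_integrable (fun w => \1_A w * x w).
Proof.
move=> mA sx; apply: square_integrable_le (sx).
  by apply: measurable_funM; [exact: measurable_indic|exact: sx.1].
move=> w; rewrite indicE; case: (_ \in _); rewrite ?mul1r// mul0r expr0n/=.
exact: sqr_ge0.
Qed.

End square_integrable.

Section martingale_differences.
Context {d : measure_display} {Omega : measurableType d} {R : realType}.
Variable P : probability Omega R.

(** The martingale property is encoded as orthogonality to the square integrable functions of the
    past. Indices are shifted: [x m] is known at time [m.+1] and centred given time [m]. *)
Definition L2_mdiff (G : nat -> set (set Omega)) (x : nat -> Omega -> R) :=
  forall m,
    [/\ measurable_fun [set: g_sigma_algebraType (G m.+1)] (x m),
        square_integrable P (x m) &
        forall Y, measurable_fun [set: g_sigma_algebraType (G m)] Y ->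
          square_integrable P Y -> (\int[P]_w (x m w * Y w)%:E = 0)%E].

Section fixed_filtration.
Variable G : nat -> set (set Omega).
Hypothesis sG : forall m, <<s G m>> `<=` measurable.
Hypothesis G_nd : forall m, <<s G m>> `<=` <<s G m.+1>>.

Lemma sub_filtration m n : (m <= n)%N -> <<s G m>> `<=` <<s G n>>.
Proof.
move=> /subnK <-; elim: (n - m)%N => // k ih.
by apply: subset_trans ih _; rewrite addSn; exact: G_nd.
Qed.

Lemma measurable_filtration m n (f : Omega -> R) : (m <= n)%N ->
  measurable_fun [set: g_sigma_algebraType (G m)] f ->
  measurable_fun [set: g_sigma_algebraType (G n)] f.
Proof. by move=> mn mf _ B mB; apply: (sub_filtration mn); exact: mf. Qed.

Variable x : nat -> Omega -> R.
Hypothesis x_md : L2_mdiff G x.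

Let S M w := \sum_(i < M) x i w.

Lemma measurable_partial_sum m M : (m <= M)%N ->
  measurable_fun [set: g_sigma_algebraType (G M)] (S m).
Proof.
move=> mM; apply: measurable_sum => i; have [mx _ _] := x_md i.
by apply: measurable_filtration mx; rewrite (leq_trans _ mM).
Qed.

Lemma square_integrable_partial_sum M : square_integrable P (S M).
Proof.
elim: M => [|M ih].
  by rewrite (_ : S 0 = fun=> 0) ?funeqE// => [|w];
    [exact: square_integrable0|rewrite /S big_ord0].
rewrite (_ : S M.+1 = fun w => S M w + x M w).
  by apply: square_integrableD => //; have [] := x_md M.
by apply/funext => w; rewrite /S big_ord_recr.
Qed.

(** Pythagoras: [S M] is measurable at time [M], so its product with the next difference [x M] has
    integral zero. *)
Lemma integral_sqr_partial_sum M :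
  (\int[P]_w (S M w ^+ 2)%:E = \sum_(i < M) \int[P]_w (x i w ^+ 2)%:E)%E.
Proof.
elim: M => [|M ih].
  rewrite big_ord0; under eq_integral do rewrite /S big_ord0 expr0n/=.
  exact: integral0.
rewrite big_ord_recr/= -ih; have [mx sx xS0] := x_md M.
have sS := square_integrable_partial_sum M.
have sxS := integrable_mul sx sS.
have S2 := sS.2; have x2 := sx.2.
transitivity (\int[P]_w (((S M w ^+ 2)%:E + (x M w ^+ 2)%:E) +
    ((x M w * S M w)%:E + (x M w * S M w)%:E)))%E.
  apply: eq_integral => w _; rewrite -!EFinD; congr EFin.
  by rewrite /S big_ord_recr/=; ring.
rewrite integralD//; [|exact: integrableD..].
have xS : (\int[P]_w (x M w * S M w)%:E = 0)%E.
  by apply: xS0 => //; exact: measurable_partial_sum.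
by rewrite !integralD// xS !adde0.
Qed.

(** A predictable indicator can be moved onto the test function [Y]. This is what makes stopping and
    localisation preserve martingale differences. *)
Lemma L2_mdiff_indic (A : nat -> set Omega) : (forall m, <<s G m>> (A m)) ->
  L2_mdiff G (fun m w => \1_(A m) w * x m w).
Proof.
move=> GA m; have [mx sx x0] := x_md m; split.
- apply: measurable_funM => //.
  by apply: (@measurable_indic _ (g_sigma_algebraType (G m.+1))); exact: G_nd.
- by apply: square_integrable_indic => //; exact: (sG (GA m)).
- move=> Y mY sY; rewrite -[RHS](x0 (fun w => \1_(A m) w * Y w)).
  + by apply: eq_integral => w _; rewrite mulrCA mulrA.
  + apply: measurable_funM => //.
    by apply: (@measurable_indic _ (g_sigma_algebraType (G m))); exact: GA.
  + by apply: square_integrable_indic => //; exact: (sG (GA m)).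
Qed.

End fixed_filtration.

Lemma L2_mdiff_shift (G : nat -> set (set Omega)) (x : nat -> Omega -> R) N :
  L2_mdiff G x -> L2_mdiff (fun m => G (N + m)%N) (fun m => x (N + m)%N).
Proof. by move=> x_md m; have := x_md (N + m)%N; rewrite addnS. Qed.

(** * Kolmogorov's maximal inequality *)

Section maximal_inequality.
Variable G : nat -> set (set Omega).
Hypothesis sG : forall m, <<s G m>> `<=` measurable.
Hypothesis G_nd : forall m, <<s G m>> `<=` <<s G m.+1>>.
Variable x : nat -> Omega -> R.
Hypothesis x_md : L2_mdiff G x.

Let S M w := \sum_(i < M) x i w.

Let bounded_up_to (e : R) M := [set w | forall j, (j <= M)%N -> `|S j w| < e].

Let sub_measurable_bounded_up_to (e : R) M : <<s G M>> (bounded_up_to e M).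
Proof.
rewrite (_ : bounded_up_to e M =
    \bigcap_(j in `I_M.+1) (fun w => `|S j w|) @^-1` `]-oo, e[); last first.
  by apply/seteqP; split => w h j; have := h j; rewrite /= in_itv/=.
apply: (@bigcap_measurableType _ (g_sigma_algebraType (G M))) => j /= jM.
rewrite -[X in _ X]setTI.
have : measurable_fun [set: g_sigma_algebraType (G M)] (fun w => `|S j w|).
  by apply: measurableT_comp => //; exact: (measurable_partial_sum G_nd x_md).
by apply => //; exact: measurable_itv.
Qed.

(* Kolmogorov's inequality, through the sum stopped when it first leaves
   ]-e, e[. *)
Lemma kolmogorov_inequality (e : R) M : 0 < e ->
  ((e ^+ 2)%:E * P (~` bounded_up_to e M) <=
   \sum_(i < M) \int[P]_w (x i w ^+ 2)%:E)%E.
Proof.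
move=> e0; set A := bounded_up_to e.
have GA m : <<s G m>> (A m) by exact: sub_measurable_bounded_up_to.
have mAC : measurable (~` A M) by apply: measurableC; exact: (sG (GA M)).
have y_md := L2_mdiff_indic sG G_nd x_md GA.
(* The stopped sum: [x i] is kept as long as none of [S 0], ..., [S i] has reached [e] in absolute
   value. *)
pose T w := \sum_(i < M) \1_(A i) w * x i w.
have mT : measurable_fun [set: Omega] T.
  apply: measurable_sum => i.
  by have [/(sub_measurable_fun (@sG i.+1))] := y_md i.
have mT2 : measurable_fun [set: Omega] (fun w => (T w ^+ 2)%:E).
  by apply/measurable_EFinP; exact: measurable_funX.
apply: (@le_trans _ _ (\int[P]_w (T w ^+ 2)%:E)%E); last first.
  rewrite (integral_sqr_partial_sum G_nd y_md); apply: lee_sum => i _.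
  apply: ge0_le_integral => //.
  - by move=> w _; rewrite lee_fin sqr_ge0.
  - by have [_ [_ /measurable_int]] := y_md i.
  - by have [_ [_ /measurable_int]] := x_md i.
  - move=> w _; rewrite lee_fin indicE; case: (_ \in _); rewrite ?mul1r//.
    by rewrite mul0r expr0n/= sqr_ge0.
apply: (@le_trans _ _ (\int[P]_(w in ~` A M) (T w ^+ 2)%:E)%E); last first.
  by apply: ge0_subset_integral => // w _; rewrite lee_fin sqr_ge0.
rewrite -integral_cst//; apply: ge0_le_integral => //=.
- by move=> w _; rewrite lee_fin sqr_ge0.
- exact: measurable_funTS.
move=> w Aw; rewrite lee_fin.
have ex : exists m, (m <= M)%N && (e <= `|S m w|).
  apply: contrapT => /forallNP h; apply: Aw => j jM.
  by rewrite ltNge; apply/negP => ej; apply: (h j); rewrite jM ej.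
(* [m] is the first exit time. The indicator of [A i] at [w] is 1 exactly when [i < m], so the
   stopped sum equals [S m w], of absolute value at least [e]. *)
have [m /andP[mM em] mmin] := ex_minnP ex.
have Sj j : (j < m)%N -> `|S j w| < e.
  move=> jm; rewrite ltNge; apply/negP => ej.
  by have := mmin j; rewrite ej (leq_trans (ltnW jm) mM) leqNgt jm => /(_ isT).
have -> : T w = S m w.
  rewrite /T /S (big_ord_widen _ (fun i => x i w) mM) [RHS]big_mkcond/=.
  apply: eq_bigr => i _; rewrite indicE; case: ltnP => im.
    rewrite mem_set ?mul1r// => j ji; apply: Sj.
    exact: leq_ltn_trans ji im.
  by rewrite memNset ?mul0r// => /(_ m im); rewrite ltNge em.
by rewrite -[leRHS]real_normK ?num_real// lerXn2r ?nnegrE// ltW.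
Qed.

(** The exit events increase with [M]: continuity of [P] from below passes to the limit in the
    finite inequality. *)
Lemma kolmogorov_inequality_infty (e : R) : 0 < e ->
  measurable (\bigcup_M (~` bounded_up_to e M)) /\
  ((e ^+ 2)%:E * P (\bigcup_M (~` bounded_up_to e M)) <=
   \sum_(i <oo) \int[P]_w (x i w ^+ 2)%:E)%E.
Proof.
move=> e0.
have mAC M : measurable (~` bounded_up_to e M).
  by apply: measurableC; exact: (sG (@sub_measurable_bounded_up_to e M)).
split; first exact: bigcup_measurable.
have AC_nd : nondecreasing_seq (fun M => ~` bounded_up_to e M).
  move=> M N MN; apply/subsetPset; apply: subsetC => w h j jM.
  by apply: h; exact: leq_trans jM MN.
have cP := @nondecreasing_cvg_mu _ _ _ P _ mAC (bigcup_measurable (fun k _ =>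
  mAC k)) AC_nd.
have cP' : ((e ^+ 2)%:E * P (~` bounded_up_to e M))%E @[M --> \oo] -->
    ((e ^+ 2)%:E * P (\bigcup_M (~` bounded_up_to e M)))%E.
  by apply: cvgeZl => //; exact: cP.
rewrite -(cvg_lim _ cP')//; apply: lime_le; first by apply/cvg_ex; eexists;
  exact: cP'.
apply: nearW => M; apply: (le_trans (kolmogorov_inequality M e0)).
rewrite -(big_mkord xpredT (fun i => \int[P]_w (x i w ^+ 2)%:E)%E).
apply: nneseries_lim_ge => // k _ _.
by apply: integral_ge0 => w _; rewrite lee_fin sqr_ge0.
Qed.

End maximal_inequality.
End martingale_differences.

(** * Almost sure convergence of square integrable martingale sums *)

Section martingale_convergence.
Context {d : measure_display} {Omega : measurableType d} {R : realType}.
Variable P : probability Omega R.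
Variable G : nat -> set (set Omega).
Hypothesis sG : forall m, <<s G m>> `<=` measurable.
Hypothesis G_nd : forall m, <<s G m>> `<=` <<s G m.+1>>.
Variable x : nat -> Omega -> R.
Hypothesis x_md : L2_mdiff P G x.
Hypothesis x_sum : (\sum_(i <oo) \int[P]_w (x i w ^+ 2)%:E < +oo)%E.

Lemma L2_mdiff_ae_cvg :
  {ae P, forall w, cvgn (fun M => \sum_(i < M) x i w)}.
Proof.
(* The event that some partial sum started at index [N] reaches [k.+1%:R^-1] in absolute value. Its
   probability is controlled by the tail from [N] of the series of second moments, so for each [k]
   the intersection over [N] is negligible. *)
pose B (k N : nat) := \bigcup_M (~` [set w | forall j, (j <= M)%N ->
  `|\sum_(i < j) x (N + i)%N w| < k.+1%:R^-1 :> R]).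
have k0 (k : nat) : 0 < k.+1%:R^-1 :> R by rewrite invr_gt0.
have sGN N m : <<s G (N + m)%N>> `<=` measurable by exact: sG.
have GN_nd N m : <<s G (N + m)%N>> `<=` <<s G (N + m.+1)%N>>.
  by rewrite addnS; exact: G_nd.
have x2_ge0 i : (0 <= \int[P]_w (x i w ^+ 2)%:E)%E.
  by apply: integral_ge0 => w _; rewrite lee_fin sqr_ge0.
have BP k N := kolmogorov_inequality_infty (sGN N) (GN_nd N)
  (@L2_mdiff_shift _ _ _ P G x N x_md) (k0 k).
have mB k : measurable (\bigcap_N B k N).
  by apply: bigcap_measurableType => N _; have [] := BP k N.
have B0 k : P.-negligible (\bigcap_N B k N).
  apply/negligibleP => //; apply/eqP; rewrite eq_le measure_ge0 andbT.
  rewrite -(@lee_pmul2l _ ((k.+1%:R^-1 ^+ 2)%:E))// ?lte_fin ?exprn_gt0//.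
  rewrite mule0.
  have tail := nneseries_tail_cvg x_sum (fun i _ => x2_ge0 i).
  rewrite -(cvg_lim _ tail)//; apply: lime_ge; first by apply/cvg_ex; eexists;
    exact: tail.
  apply: nearW => N; have [mBN BN] := BP k N.
  have -> : (\sum_(N <= i <oo) \int[P]_w (x i w ^+ 2)%:E =
      \sum_(i <oo) \int[P]_w (x (N + i)%N w ^+ 2)%:E)%E.
    by rewrite -nneseries_addn//; apply: eq_eseriesr => i _; rewrite addnC.
  apply: le_trans BN; rewrite lee_pmul2l ?lte_fin ?exprn_gt0//.
  by apply: le_measure; rewrite ?inE// => w /(_ N Logic.I).
have : {ae P, forall w, forall k, ~ (\bigcap_N B k N) w}.
  by apply: ae_foralln => k; apply: negligibleS (B0 k) => w /= /contrapT.
apply: filterS => w h.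
apply/cauchy_cvgP/cauchy_exP => e e0.
pose k := Num.truncn e^-1.
have ke : k.+1%:R^-1 < e.
  by rewrite invf_plt ?posrE// truncnS_gt.
have [N BN] : exists N, ~ B k N w.
  by apply: contrapT => /forallNP hN; apply: (h k) => N _; apply: contrapT;
    exact: hN.
(* Outside [B k N], every later partial sum stays within [e] of the one at [N]: this is the Cauchy
   criterion. *)
exists (\sum_(i < N) x i w); exists N => // n /= Nn.
rewrite -ball_normE/=; apply: lt_trans ke.
rewrite distrC -(subnKC Nn) big_split_ord/= addrAC subrr add0r ltNge.
apply/negP => ge.
by apply: BN; exists (n - N)%N => // /(_ _ (leqnn _)); rewrite ltNge ge.
Qed.

End martingale_convergence.

(** * Conditional convergence of vector-valued sums *)

Section conditional_L2_convergence.
Context {d : measure_display} {Omega : measurableType d} {R : realType} {p :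
  nat}.
Variable P : probability Omega R.
Variable G : nat -> set (set Omega).
Hypothesis sG : forall m, <<s G m>> `<=` measurable.
Hypothesis G_nd : forall m, <<s G m>> `<=` <<s G m.+1>>.
Variable v : nat -> Omega -> 'cV[R]_p.
Hypothesis sub_mv : forall i j,
  measurable_fun [set: g_sigma_algebraType (G i.+1)] (fun w => v i w j 0).
Hypothesis v_centered : forall i j A, <<s G i>> A ->
  (\int[P]_(w in A) (Num.max (v i w j 0) 0)%:E =
   \int[P]_(w in A) (Num.max (- v i w j 0) 0)%:E)%E.
Variable Zv : Omega -> \bar R.
Hypothesis Zv_cond : cond_exp_ge0 P <<s G 0%N>>
  (fun w => \sum_(i <oo) (sqnorm (v i w))%:E)%E Zv.
Hypothesis Zv_fin : {ae P, forall w, (Zv w < +oo)%E}.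

Let D M w := \sum_(i < M) v i w.

Lemma nneseries_ge_term (u : (\bar R)^nat) i : (forall k, 0 <= u k)%E ->
  (u i <= \sum_(k <oo) u k)%E.
Proof.
move=> u0; apply: le_trans (nneseries_lim_ge i.+1 (fun k _ _ => u0 k)).
by rewrite big_nat_recr//= leeDr// sume_ge0.
Qed.

Lemma sqnorm_ge0 (u : 'cV[R]_p) : 0 <= sqnorm u.
Proof. by apply: sumr_ge0 => i _; exact: sqr_ge0. Qed.

Lemma sqr_coord_le_sqnorm (u : 'cV[R]_p) j : u j 0 ^+ 2 <= sqnorm u.
Proof. by rewrite /sqnorm (bigD1 j)//= lerDl sumr_ge0// => i _;
  exact: sqr_ge0. Qed.

Lemma measurable_sqnorm (u : Omega -> 'cV[R]_p) :
  (forall j, measurable_fun [set: Omega] (fun w => u w j 0)) ->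
  measurable_fun [set: Omega] (fun w => sqnorm (u w)).
Proof. by move=> mu; apply: measurable_sum => j; exact: measurable_funX. Qed.

Let mv i j : measurable_fun [set: Omega] (fun w => v i w j 0).
Proof. exact: (sub_measurable_fun (@sG i.+1) (@sub_mv i j)). Qed.

Let msq i : measurable_fun [set: Omega] (fun w => sqnorm (v i w)).
Proof. exact: measurable_sqnorm. Qed.

Let mEsq i : measurable_fun [set: Omega] (fun w => (sqnorm (v i w))%:E).
Proof. exact/measurable_EFinP. Qed.

Let square_sum w := (\sum_(i <oo) (sqnorm (v i w))%:E)%E.

(** The localising sets: known at time 0, with an integrable sum of squares. On them, conditional
    square integrability becomes ordinary square integrability. *)
Let finite_energy (B : set Omega) :=
  <<s G 0%N>> B /\ (\int[P]_(w in B) square_sum w < +oo)%E.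

Let integral_square_sum (B : set Omega) : measurable B ->
  (\int[P]_(w in B) square_sum w =
    \sum_(i <oo) \int[P]_(w in B) (sqnorm (v i w))%:E)%E.
Proof.
move=> mB; rewrite integral_nneseries// => [i|i w _].
  exact: measurable_funTS.
by rewrite lee_fin sqnorm_ge0.
Qed.

Let integral_coord_indic (B : set Omega) (u : Omega -> R) :
  (\int[P]_w ((\1_B w * u w) ^+ 2)%:E = \int[P]_(w in B) (u w ^+ 2)%:E)%E.
Proof.
rewrite -[RHS]integral_mulr_indic; apply: eq_integral => w _.
by rewrite indicE; case: (_ \in _);
  rewrite ?mul1r ?mul0r ?expr0n/= ?mule1 ?mule0.
Qed.

Let integral_coord_le (B : set Omega) i j : measurable B ->
  (\int[P]_(w in B) (v i w j 0 ^+ 2)%:E <= \int[P]_(w in B) (sqnorm (v i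
    w))%:E)%E.
Proof.
move=> mB; apply: ge0_le_integral => //.
- by move=> w _; rewrite lee_fin sqr_ge0.
- by apply: measurable_funTS; apply/measurable_EFinP; exact: measurable_funX.
- exact: measurable_funTS.
- by move=> w _; rewrite lee_fin sqr_coord_le_sqnorm.
Qed.

Let localised_sum_lty (B : set Omega) j : finite_energy B ->
  (\sum_(i <oo) \int[P]_w ((\1_B w * v i w j 0) ^+ 2)%:E < +oo)%E.
Proof.
move=> [GB]; have mB := sG GB; rewrite integral_square_sum//;
  apply: le_lt_trans.
apply: lee_nneseries => [i _ _|i _]; first by apply: integral_ge0 => w _;
  rewrite lee_fin sqr_ge0.
by rewrite integral_coord_indic integral_coord_le.
Qed.

(** As [B] belongs to every [<<s G i>>], its indicator can be absorbed in the test function.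
    [centered_orthogonal] then applies even if [v i] itself is not integrable. *)
Let localised_mdiff (B : set Omega) j : finite_energy B ->
  L2_mdiff P G (fun i w => \1_B w * v i w j 0).
Proof.
move=> EB i; have [GB _] := EB; have mB := sG GB.
have GiB : <<s G i>> B by exact: (sub_filtration G_nd (leq0n i)).
have mBv : measurable_fun [set: Omega] (fun w => \1_B w * v i w j 0).
  by apply: measurable_funM => //; exact: measurable_indic.
have sBv : square_integrable P (fun w => \1_B w * v i w j 0).
  apply: square_integrableP => //.
  apply: le_lt_trans (localised_sum_lty j EB).
  apply: (@nneseries_ge_term (fun i => \int[P]_w ((\1_B w * v i w j 0) ^+
    2)%:E)%E) => k.
  by apply: integral_ge0 => w _; rewrite lee_fin sqr_ge0.
split => //.
- apply: measurable_funM => //.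
  by apply: (@measurable_indic _ (g_sigma_algebraType (G i.+1))); exact: G_nd.
- move=> Y mY sY.
  transitivity (\int[P]_w (v i w j 0 * (\1_B w * Y w))%:E)%E.
    by apply: eq_integral => w _; rewrite mulrA (mulrC (v i w j 0)).
  apply: (centered_orthogonal (@sG i)) => //; first exact: v_centered.
    by apply: measurable_funM => //;
      exact: (@measurable_indic _ (g_sigma_algebraType (G i))).
  rewrite (_ : (fun w => _) = (fun w => (\1_B w * v i w j 0 * Y w)%:E)).
    exact: integrable_mul.
  by apply/funext => w; rewrite mulrA (mulrC (v i w j 0)).
Qed.

Let level k := [set w | (Zv w <= k%:R%:E)%E].

Let sub_measurable_level k : <<s G 0%N>> (level k).
Proof.
have [_ mZ _] := Zv_cond.
rewrite (_ : level k = Zv @^-1` `]-oo, k%:R%:E]); first by apply: mZ;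
  exact: emeasurable_itv.
by apply/seteqP; split => w; rewrite /level/= in_itv.
Qed.

Let level_cover : {ae P, forall w, exists k, level k w}.
Proof.
have [Z0 _ _] := Zv_cond.
apply: filterS Zv_fin => w Zw.
have Zfin : Zv w \is a fin_num by rewrite ge0_fin_numE.
exists (Num.truncn (fine (Zv w))).+1; rewrite /level/= -(fineK Zfin) lee_fin.
exact/ltW/truncnS_gt.
Qed.

(** Over a set known at time 0, the sum of squares and its conditional expectation [Zv] have the
    same integral, and [Zv] is at most [k] on the level set. *)
Let level_finite_energy k B : <<s G 0%N>> B -> B `<=` level k ->
  finite_energy B.
Proof.
move=> GB Bk; split => //; have mB := sG GB; have [Z0 _ ZE] := Zv_cond.
have mZ := sub_measurable_fun (@sG 0%N) (cond_exp_ge0_measurable Zv_cond).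
rewrite -ZE//; apply: (@le_lt_trans _ _ (\int[P]_(w in B) (cst k%:R%:E) w))%E.
  apply: ge0_le_integral => //; first exact: measurable_funTS.
rewrite integral_cst// ltey_eq fin_numM//; exact: fin_num_measure.
Qed.

Let coord_D M w j : D M w j 0 = \sum_(i < M) v i w j 0.
Proof. by rewrite /D summxE. Qed.

Let D_ae_cvg : {ae P, forall w j, cvgn (fun M => D M w j 0)}.
Proof.
have h k j : {ae P, forall w, cvgn (fun M => \sum_(i < M) \1_(level k) w * v i
  w j 0)}.
  have Ek : finite_energy (level k) by exact: (@level_finite_energy k).
  exact: (L2_mdiff_ae_cvg sG G_nd (localised_mdiff j Ek) (localised_sum_lty j
    Ek)).
have h' : {ae P, forall w, forall k j,
    cvgn (fun M => \sum_(i < M) \1_(level k) w * v i w j 0)}.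
  by apply: ae_foralln => k; apply: filter_forall => j; exact: h.
apply: filterS2 h' level_cover => w hw [k kw] j.
have := hw k j; under eq_fun do under eq_bigr do rewrite indicE mem_set// mul1r.
by under [in X in _ -> X]eq_fun do rewrite coord_D.
Qed.

(** An upper limit exists at every point and is measurable, and it is the limit wherever [D]
    converges. [fine] sends infinite values to 0. *)
Let Dinf w := \col_j fine (limn_esup (fun M => (D M w j 0)%:E)).

Let mD M j : measurable_fun [set: Omega] (fun w => D M w j 0).
Proof.
under eq_fun do rewrite coord_D.
exact: measurable_sum.
Qed.

Let mDinf j : measurable_fun [set: Omega] (fun w => Dinf w j 0).
Proof.
under eq_fun do rewrite mxE.
apply: measurableT_comp => //.
by apply: measurable_fun_limn_esup => M; exact/measurable_EFinP.
Qed.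

Let D_cvg : {ae P, forall w, D ^~ w @ \oo --> Dinf w}.
Proof.
apply: filterS D_ae_cvg => w cD; apply/mx_cvgP => i j; rewrite !ord1 mxE.
have cE : (D M w i 0)%:E @[M --> \oo] --> (limn (fun M => D M w i 0))%:E.
  by apply: cvg_EFin; [exact: nearW|exact: cD].
by have [_ ->] := cvg_limn_einf_sup cE; exact: cD.
Qed.

(** Orthogonality, coordinate by coordinate, for the localised differences shifted by [M]. *)
Let integral_increment (B : set Omega) M k : finite_energy B ->
  (\int[P]_(w in B) (sqnorm (D (M + k) w - D M w))%:E =
   \sum_(i < k) \int[P]_(w in B) (sqnorm (v (M + i)%N w))%:E)%E.
Proof.
move=> EB; have [GB _] := EB; have mB := sG GB.
have sqE (u : Omega -> 'cV[R]_p) :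
  (forall j, measurable_fun [set: Omega] (fun w => u w j 0)) ->
    (\int[P]_(w in B) (sqnorm (u w))%:E =
     \sum_(j < p) \int[P]_(w in B) (u w j 0 ^+ 2)%:E)%E.
  move=> mu; rewrite -ge0_integral_sum//.
  - by apply: eq_integral => w _; rewrite /sqnorm sumEFin.
  - move=> j; apply/measurable_funTS/measurable_EFinP; exact: measurable_funX.
  - by move=> j w _; rewrite lee_fin sqr_ge0.
rewrite sqE; last first.
  move=> j; under eq_fun do rewrite mxE [X in _ + X]mxE.
  exact: measurable_funB.
under [RHS]eq_bigr do rewrite sqE//.
rewrite exchange_big/=; apply: eq_bigr => j _.
have shift_md := @L2_mdiff_shift _ _ _ P G _ M (localised_mdiff j EB).
have GM m : <<s G (M + m)%N>> `<=` <<s G (M + m.+1)%N>>.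
  by rewrite addnS; exact: G_nd.
have := integral_sqr_partial_sum GM shift_md k.
under [in X in _ = X -> _]eq_bigr do rewrite integral_coord_indic.
move=> <-; rewrite -(integral_coord_indic B (fun w => (D (M + k) w - D M w) j
  0)); apply: eq_integral => w _.
congr ((_ ^+ 2)%:E); rewrite -mulr_sumr; congr (_ * _).
by rewrite !mxE !coord_D big_split_ord/= addrAC subrr add0r.
Qed.

Let sqnormB (a b : 'cV[R]_p) : sqnorm (a - b) = sqnorm (b - a).
Proof. by apply: eq_bigr => j _; rewrite !mxE -sqrrN opprB. Qed.

Let cvg_sqnorm (u : nat -> 'cV[R]_p) l : u @ \oo --> l ->
  (fun k => sqnorm (u k)) @ \oo --> sqnorm l.
Proof.
move=> /mx_cvgP ul; rewrite /sqnorm.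
apply: cvg_big => [|j _]; first exact:
  (@pseudometric_normed_Zmodule.add_continuous R R^o).
by rewrite expr2; under eq_fun do rewrite expr2; exact: cvgM.
Qed.

Let mDD M N : measurable_fun [set: Omega] (fun w => sqnorm (D M w - D N w)).
Proof.
apply: measurable_sqnorm => j; under eq_fun do rewrite mxE [X in _ + X]mxE.
exact: measurable_funB.
Qed.

Let mDDinf M : measurable_fun [set: Omega] (fun w => sqnorm (D M w - Dinf w)).
Proof.
apply: measurable_sqnorm => j; under eq_fun do rewrite mxE [X in _ + X]mxE.
exact: measurable_funB.
Qed.

(** Fatou's lemma along [D (M + k)], which tends to [Dinf] almost surely as [k] grows. Each
    increment is bounded by a partial sum of the right-hand side. *)
Let integral_remainder (B : set Omega) M : finite_energy B ->
  (\int[P]_(w in B) (sqnorm (D M w - Dinf w))%:E <=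
   \sum_(i <oo) \int[P]_(w in B) (sqnorm (v (i + M)%N w))%:E)%E.
Proof.
move=> EB; have [GB _] := EB; have mB := sG GB.
pose f k w := (sqnorm (D (M + k) w - D M w))%:E.
have mf k : measurable_fun B (f k) by apply/measurable_funTS/measurable_EFinP.
have f0 k w : B w -> (0 <= f k w)%E by move=> _; rewrite lee_fin sqnorm_ge0.
have -> : (\int[P]_(w in B) (sqnorm (D M w - Dinf w))%:E =
    \int[P]_(w in B) limn_einf (f ^~ w))%E.
  apply: ae_eq_integral => //.
  - by apply/measurable_funTS/measurable_EFinP.
  (* Measurability of the lower limit is obtained from that of the upper limit of the opposite
     sequence. *)
  - rewrite (_ : (fun w => _) =
      -%E \o (fun w => limn_esup (fun k => - f k w)))%E.
      apply: measurableT_comp => //; apply: measurable_fun_limn_esup => k.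
      exact: measurableT_comp.
    by apply/funext => w /=; rewrite (limn_esupN (f ^~ w)) oppeK.
  - apply: filterS D_cvg => w Dw _; apply/esym.
    have cf : f k w @[k --> \oo] --> (sqnorm (Dinf w - D M w))%:E.
      apply: cvg_EFin; first exact: nearW.
      apply: cvg_sqnorm; apply: cvgB; last exact: cvg_cst.
      by under eq_fun do rewrite addnC; move: Dw; rewrite -(cvg_shiftn M).
    by rewrite sqnormB; have [-> _] := cvg_limn_einf_sup cf.
apply: le_trans (fatou P mB mf f0) _.
rewrite limn_einf_lim; apply: lime_le; first exact: is_cvg_einfs.
apply: nearW => k; apply: (@le_trans _ _ (\int[P]_(w in B) f k w)%E).
  by apply: ereal_inf_lbound; exists k => /=.
rewrite integral_increment//.
under eq_bigr do rewrite addnC.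
rewrite -(big_mkord xpredT (fun i => \int[P]_(w in B) (sqnorm (v (i + M)%N
  w))%:E)%E).
apply: nneseries_lim_ge => i _ _.
by apply: integral_ge0 => w _; rewrite lee_fin sqnorm_ge0.
Qed.

Lemma conditional_L2_convergence : exists Dinf : Omega -> 'cV[R]_p,
  [/\ forall j, measurable_fun [set: Omega] (fun w => Dinf w j 0),
      {ae P, forall w, D ^~ w @ \oo --> Dinf w} &
      cond_cvg_L2 P <<s G 0%N>> D Dinf].
Proof.
exists Dinf; split => //.
have /choice [V Vh] : forall i, exists V, cond_exp_ge0 P <<s G 0%N>>
    (EFin \o (fun w => sqnorm (v i w))) V.
  by move=> i; apply: cond_exp_ge0_exists => // w; exact: sqnorm_ge0.
have V0 i w : (0 <= V i w)%E by have [] := Vh i.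
have mV i := cond_exp_ge0_measurable (Vh i).
have VE i B : <<s G 0%N>> B ->
    (\int[P]_(w in B) V i w = \int[P]_(w in B) (sqnorm (v i w))%:E)%E.
  by have [_ _] := Vh i; exact.
(* The tail from index [M] of the conditional second moments. It dominates the conditional
   expectation of the squared distance from [D M] to [Dinf]. *)
pose T M w := (\sum_(i <oo) V (i + M)%N w)%E.
have T0 M w : (0 <= T M w)%E by apply: nneseries_ge0.
have mT M : measurable_fun [set: g_sigma_algebraType (G 0%N)] (T M).
  by apply: ge0_emeasurable_sum => // i _; exact: mV.
have TE M B : <<s G 0%N>> B -> (\int[P]_(w in B) T M w =
    \sum_(i <oo) \int[P]_(w in B) (sqnorm (v (i + M)%N w))%:E)%E.
  move=> GB; have mB := sG GB; rewrite integral_nneseries//; last first.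
    by move=> i; apply/measurable_funTS/(sub_measurable_fun (@sG 0%N));
      exact: mV.
  by apply: eq_eseriesr => i _; exact: VE.
have TM_le_T0 M w : (T M w <= T 0%N w)%E.
  rewrite /T (nneseries_addn M (fun i => V0 i w)).
  under [leRHS]eq_eseriesr do rewrite addn0.
  rewrite (nneseries_split 0 M)// add0n leeDr// sume_ge0//.
have sub0 M B : <<s G 0%N>> B ->
    (\int[P]_(w in B) T M w <= \int[P]_(w in B) T 0%N w)%E.
  move=> GB; have mB := sG GB; apply: ge0_le_integral => //;
    by apply/measurable_funTS/(sub_measurable_fun (@sG 0%N)); exact: mT.
have T_lty k M : (\int[P]_(w in level k) T M w < +oo)%E.
  have [GB Bfin] := @level_finite_energy k (level k) (sub_measurable_level k)
    (fun _ => id).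
  apply: le_lt_trans (sub0 M _ GB) _; rewrite TE//.
  under eq_eseriesr do rewrite addn0.
  by rewrite -integral_square_sum//; exact: sG.
have T_fin : {ae P, forall w, (T 0%N w < +oo)%E}.
  by apply: integral_lty_ae_fin level_cover _ _ _ => //; exact: sG.
have dominated M (Y : Omega -> R) : (forall w, 0 <= Y w) ->
    measurable_fun [set: Omega] Y ->
    (forall B, finite_energy B ->
      \int[P]_(w in B) (Y w)%:E <= \int[P]_(w in B) T M w)%E ->
    exists2 Z, cond_exp_ge0 P <<s G 0%N>> (EFin \o Y) Z &
      {ae P, forall w, (Z w <= T M w)%E}.
  move=> Y0 mY YT.
  apply: (@cond_exp_dominated _ _ _ P _ (@sG 0%N) level) => // k B GB Bk.
  by apply: YT; exact: level_finite_energy Bk.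
have finite_dominated (Y : Omega -> R) : (forall w, 0 <= Y w) ->
    measurable_fun [set: Omega] Y ->
    (forall B, finite_energy B ->
      \int[P]_(w in B) (Y w)%:E <= \int[P]_(w in B) T 0%N w)%E ->
    cond_exp_finite P <<s G 0%N>> (EFin \o Y).
  move=> Y0 mY /(dominated 0%N _ Y0 mY)[Z ZY ZT]; exists Z => //.
  by apply: filterS2 ZT T_fin => w; exact: le_lt_trans.
have D0 w : D 0%N w = 0 by rewrite /D big_ord0.
split.
- move=> M; apply: finite_dominated.
  + by move=> w; exact: sqnorm_ge0.
  + exact: measurable_sqnorm.
  + move=> B EB; have [GB _] := EB.
    (* [D M] is rewritten as the increment of length [M] from time 0. Its second moment is thus a
       partial sum of the series for [T 0]. *)
    under eq_integral => w _ do rewrite -(subr0 (D M w)) -(D0 w) -{1}(add0n M).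
    rewrite integral_increment// TE//.
    under [leRHS]eq_eseriesr do rewrite addn0.
    rewrite -(big_mkord xpredT (fun i => \int[P]_(w in B) (sqnorm (v (0 + i)%N
      w))%:E)%E).
    apply: nneseries_lim_ge => i _ _.
    by apply: integral_ge0 => w _; rewrite lee_fin sqnorm_ge0.
- apply: finite_dominated.
  + by move=> w; exact: sqnorm_ge0.
  + exact: measurable_sqnorm.
  + move=> B EB; have [GB _] := EB.
    (* The norm of [Dinf] is the remainder at time 0. *)
    under eq_integral => w _ do rewrite -(subr0 (Dinf w)) -(D0 w) sqnormB.
    by rewrite TE//; exact: integral_remainder.
- have /choice [Z Zh] : forall M, exists Z,
      cond_exp_ge0 P <<s G 0%N>> (fun w => (sqnorm (D M w - Dinf w))%:E) Z /\
      {ae P, forall w, (Z w <= T M w)%E}.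
    move=> M; have [||B EB|Z ZY ZT] := dominated M (fun w => sqnorm (D M w -
      Dinf w)).
    + by move=> w; exact: sqnorm_ge0.
    + by [].
    + by have [GB _] := EB; rewrite TE//; exact: integral_remainder.
    + by exists Z.
  exists Z; first by move=> M; have [] := Zh M.
  have ZT : {ae P, forall w, forall M, (Z M w <= T M w)%E}.
    by apply: ae_foralln => M; have [] := Zh M.
  apply: filterS2 ZT T_fin => w ZTw Tw.
  apply: (@squeeze_cvge _ _ _ _ (fun=> 0%E) _ (T ^~ w)).
  + apply: nearW => M; rewrite ZTw andbT.
    by have [[]] := Zh M.
  + exact: cvg_cst.
  (* Where [T 0] is finite, [T M] is the tail of a convergent series. *)
  + rewrite /T; under eq_fun do rewrite (nneseries_addn _ (fun i => V0 i w)).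
    apply: nneseries_tail_cvg => //.
    by move: Tw; rewrite /T; under eq_eseriesr do rewrite addn0.
Qed.

End conditional_L2_convergence.

(** * The predictive recursion *)

Section predictive_recursion.
Context {dT dO : measure_display} {T : measurableType dT}.
Context {Omega : measurableType dO} {R : realType} {p n : nat}.
Variable P : probability Omega R.
Variables (f : T -> 'cV[R]_p -> R) (X : 'I_n -> {RV P >-> T}).
Variables (Xt : nat -> {RV P >-> T}) (est : ('I_n -> T) -> 'cV[R]_p).

(** The generators of [filtr], isolated so that [filtr] has the form [<<s G m>>] used by the general
    results. *)
Definition filtr_gen (m : nat) : set (set Omega) :=
  [set B | exists A : set T, measurable A /\
    ((exists i : 'I_n, B = X i @^-1` A) \/
     (exists2 k, (1 <= k <= m)%N & B = Xt k @^-1` A))].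

Lemma filtr_sub_measurable m : filtr X Xt m `<=` measurable.
Proof.
apply: smallest_sub; first exact: sigma_algebra_measurable.
move=> _ [A [mA [[i ->]|[k _ ->]]]].
  by rewrite -[X in measurable X]setTI; exact: measurable_funPT.
by rewrite -[X in measurable X]setTI; exact: measurable_funPT.
Qed.

Lemma filtr_nd m : filtr X Xt m `<=` filtr X Xt m.+1.
Proof.
apply: sub_smallest2r; first exact: smallest_sigma_algebra.
move=> B [A [mA AB]]; exists A; split => //.
case: AB => [|[k /andP[k1 km] kB]]; first by left.
by right; exists k => //; rewrite k1 leqW.
Qed.

(** The recursion counts its steps from 1 and the general results count from 0: [increment i] is the
    step made at time [i.+1]. *)
Let increment i w : 'cV[R]_p := gain n i.+1 *: scores f X Xt est i.+1 w.

Lemma Dsum_increments M w : Dsum f X Xt est M w = \sum_(i < M) increment i w.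
Proof. by rewrite /Dsum big_add1/= big_mkord. Qed.

Lemma thetas_Dsum M w :
  thetas f X Xt est M w = thetas f X Xt est 0 w + Dsum f X Xt est M w.
Proof.
elim: M => [|M ih]; first by rewrite /Dsum big_geq// addr0.
by rewrite /Dsum big_nat_recr//= addrA -/(Dsum f X Xt est M w) -ih.
Qed.

Lemma sqnormZ (a : R) (u : 'cV[R]_p) : sqnorm (a *: u) = a ^+ 2 * sqnorm u.
Proof. by rewrite /sqnorm mulr_sumr; apply: eq_bigr => j _;
  rewrite mxE exprMn. Qed.

Lemma sum_sqnorm_increments w :
  (\sum_(1 <= m <oo) (gain n m ^+ 2 * sqnorm (scores f X Xt est m w))%:E =
   \sum_(i <oo) (sqnorm (increment i w))%:E)%E.
Proof.
rewrite -(@nneseries_addn _ (fun m =>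
  (gain n m ^+ 2 * sqnorm (scores f X Xt est m w))%:E) 1%N); last first.
  by move=> m; rewrite lee_fin mulr_ge0 ?sqr_ge0// sqnorm_ge0.
by apply: eq_eseriesr => i _; rewrite addn1 /increment sqnormZ.
Qed.

End predictive_recursion.

Theorem theorem1 (R : realType) (p n : nat) (dT dO : measure_display)
    (T : measurableType dT) (mu : {measure set T -> \bar R})
    (Theta : set 'cV[R]_p) (f : T -> 'cV[R]_p -> R)
    (Omega : measurableType dO) (P : probability Omega R)
    (X : 'I_n -> {RV P >-> T}) (Xt : nat -> {RV P >-> T})
    (est : ('I_n -> T) -> 'cV[R]_p)
    (Qinf : Omega -> 'M[R]_p)
    (F := filtr X Xt)
    (theta := thetas f X Xt est)
    (s := scores f X Xt est)
    (D := Dsum f X Xt est)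
    (Q := Qsum f X Xt est)
    (I := Ipath f X Xt est)
    (n_gt0 : (0 < n)%N)
    (model : is_model mu Theta f)
    (has_s : has_score mu Theta f)
    (mle : {ae P, forall w, is_mle Theta f (X ^~ w) (theta 0%N w)})
    (meas_theta0 : measurable_wrt (F 0%N) (theta 0%N))
    (meas_s : forall m, (1 <= m)%N -> measurable_wrt (F m) (s m))
    (law : predictive_law f X Xt est P mu)
    (in_Theta : {ae P, forall w, forall m, Theta (theta m w)})
    (hyp_i : forall m, (1 <= m)%N ->
       forall j, cond_exp_eq P (F m.-1) (fun w => s m w j 0) (cst 0))
    (hyp_ii : cond_exp_finite P (F 0%N)
       (fun w => (\sum_(1 <= m <oo) (gain n m ^+ 2 * sqnorm (s m w))%:E)%E))
    (hyp_iii : {ae P, forall w, Q ^~ w @ \oo --> Qinf w /\ posdefmx (Qinf w)}) :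
  let Iinf w := (winf n)^-1 *: Qinf w in
  exists Dinf : Omega -> 'cV[R]_p,
    [/\ forall j, measurable_fun [set: Omega] (fun w => Dinf w j 0),
        {ae P, forall w, D ^~ w @ \oo --> Dinf w} /\
          cond_cvg_L2 P (F 0%N) D Dinf,
        (forall M w, theta M w = theta 0%N w + D M w) /\
          {ae P, forall w, theta ^~ w @ \oo --> theta 0%N w + Dinf w},
        [/\ wsum n @ \oo --> (winf n : R), 0 < winf n :> R &
          {ae P, forall w, I ^~ w @ \oo --> Iinf w}] &
        {ae P, forall w, posdefmx (Qinf w) ->
          [/\ \forall M \near \oo, I M w \in unitmx,
              Iinf w \in unitmx &
              (theta_pc f X Xt est) ^~ w @ \oo -->
                theta 0%N w + invmx (Iinf w) *m Dinf w]}].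
Proof.
move=> Iinf.
pose G := filtr_gen X Xt.
have sG m : <<s G m>> `<=` measurable by exact: filtr_sub_measurable.
have G_nd m : <<s G m>> `<=` <<s G m.+1>> by exact: filtr_nd.
pose v i w := gain n i.+1 *: s i.+1 w.
have g_gt0 m : 0 < gain n m :> R by exact: gain_gt0.
have mv i j : measurable_fun [set: g_sigma_algebraType (G i.+1)] (fun w => v i
  w j 0).
  under eq_fun do rewrite mxE; apply: measurable_funM => //.
  by move=> _ B mB; rewrite setTI; exact: meas_s.
have ms m j : (1 <= m)%N -> measurable_fun [set: Omega] (fun w => s m w j 0).
  by move=> m1 _ B mB; rewrite setTI; apply: (sG m); exact: meas_s.
have v_centered i j A : <<s G i>> A ->
   (\int[P]_(w in A) (Num.max (v i w j 0) 0)%:E =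
    \int[P]_(w in A) (Num.max (- v i w j 0) 0)%:E)%E.
  move=> GA; have mA := sG _ _ GA.
  have [Zp [Zn [ZpP ZnP Zpfin Znfin ZE]]] := hyp_i i.+1 isT j.
  have [Zp0 _ ZpE] := ZpP; have [Zn0 _ ZnE] := ZnP.
  have mZp := sub_measurable_fun (@sG i) (cond_exp_ge0_measurable ZpP).
  have mZn := sub_measurable_fun (@sG i) (cond_exp_ge0_measurable ZnP).
  (* In the extended reals a zero difference gives equality only for finite terms, hence the almost
     sure finiteness of [Zp] and [Zn]. *)
  have Zpn : {ae P, forall w, A w -> Zp w = Zn w}.
    apply: filterS3 Zpfin Znfin ZE => w Zpw Znw + _.
    rewrite -[Zp w]fineK ?ge0_fin_numE// -[Zn w]fineK ?ge0_fin_numE//.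
    by rewrite -EFinB => -[] /esym/eqP; rewrite subr_eq0 => /eqP ->.
  (* The gain is positive, so it comes out of positive and negative parts alike and the centring of
     the scores passes to [v]. *)
  have scale (u : Omega -> R) : measurable_fun [set: Omega] u ->
      (\int[P]_(w in A) (Num.max (gain n i.+1 * u w) 0)%:E =
       (gain n i.+1)%:E * \int[P]_(w in A) (Num.max (u w) 0)%:E)%E.
    move=> mu_; rewrite -ge0_integralZl//=.
    - apply: eq_integral => w _.
      by rewrite -EFinM maxr_pMr ?mulr0// ltW.
    - by apply/measurable_funTS/measurable_EFinP; exact: measurable_maxr.
    - by move=> w _; rewrite lee_fin le_max lexx orbT.
    - by rewrite lee_fin ltW.
  under eq_integral do rewrite mxE.
  under [RHS]eq_integral do rewrite mxE -mulrN.
  have ms1 := ms i.+1 j isT.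
  have msN : measurable_fun [set: Omega] (fun w => - s i.+1 w j 0).
    exact: measurableT_comp.
  rewrite (scale _ ms1) (scale _ msN).
  congr (_ * _)%E; rewrite -ZpE// -ZnE//.
  by apply: ge0_ae_eq_integral => //; exact: measurable_funTS.
have Zv_ex : cond_exp_finite P <<s G 0%N>> (fun w => \sum_(i <oo) (sqnorm (v i
  w))%:E)%E.
  have -> : (fun w => \sum_(i <oo) (sqnorm (v i w))%:E)%E =
    (fun w => (\sum_(1 <= m <oo) (gain n m ^+ 2 * sqnorm (s m w))%:E)%E).
    by apply/funext => w; rewrite -sum_sqnorm_increments.
  exact: hyp_ii.
have [Zv Zv_cond Zv_fin] := Zv_ex.
have [Dinf [mDinf Dcvg D2]] :=
  conditional_L2_convergence sG G_nd mv v_centered Zv_cond Zv_fin.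
have DE : D = fun M w => \sum_(i < M) v i w.
  by apply/funext => M; apply/funext => w; exact: Dsum_increments.
have cD : {ae P, forall w, D ^~ w @ \oo --> Dinf w} by rewrite DE.
have theta_D M w : theta M w = theta 0%N w + D M w by exact: thetas_Dsum.
have cw := @cvg_wsum R n n_gt0; have w0 := @winf_gt0 R n n_gt0.
(* The limit [winf n] is positive, so the reciprocals of [wsum n M] converge. *)
have cI w : Q ^~ w @ \oo --> Qinf w -> I ^~ w @ \oo --> Iinf w.
  move=> /mx_cvgP cQ; apply/mx_cvgP => i j; rewrite mxE.
  under eq_fun do rewrite mxE.
  by apply: cvgM => //; apply: cvgV => //; rewrite gt_eqF.
exists Dinf; split => //.
- by split=> //; rewrite DE.
- split=> //; apply: filterS cD => w Dw.
  by under eq_fun do rewrite theta_D; apply: cvgD => //; exact: cvg_cst.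
- by split=> //; apply: filterS hyp_iii => w [cQ _]; exact: cI.
- apply: filterS2 hyp_iii cD => w [cQ _] Dw Qpos.
  have Iu : Iinf w \in unitmx.
    by rewrite unitmxZ ?posdefmx_unit// unitfE invr_eq0 gt_eqF.
  have cIw := cI w cQ.
  split=> //; first exact: near_unitmx Iu.
  apply: cvgD; first exact: cvg_cst.
  by apply: cvg_mulmx => //; exact: cvg_invmx.
Qed.
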